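(* Consider single-machine scheduling with all jobs available at time $0$, and suppose at most $g$ jobs are overestimated (i.e. satisfy $\hat p_j > p_j$); $g$ is known to the algorithm. Then for every $\varepsilon>0$, the adapted PMLF (with parameters $\delta,\gamma>0$ chosen appropriately depending on $\varepsilon$) is $2(1+\varepsilon)$-competitive for minimizing total completion time and incurs at most $$O\Big(\frac{1}{\varepsilon}\sum_j\Big(1+\log_2\frac{p_j}{\hat p_j}\Big)+\frac{g}{\varepsilon^2}\log_2\big(\max_j p_j\big)\Big)$$ preemptions in total.
   Context: There are $n$ jobs, all available at time $0$, on a single machine that processes at most one job at a time at unit speed; preemption is allowed. Job $j$ has an unknown processing requirement $p_j\ge 1$ and completes once it has received $p_j$ units of processing; $p_j$ is learned only at completion. For each job a prediction $\hat p_j>0$ is known. A preemption is an interruption of a job's processing before it completes. An algorithm is $c$-competitive if on every instance its total completion time $\sum_j C_j$ is at most $c$ times the optimal offline total completion time. PMLF with parameter $\delta>0$: maintain FIFO queues $Q_k$ indexed by integers $k$; initially job $j$ is placed into $Q_k$ with $k=\lfloor\log_{1+\delta}\hat p_j\rfloor$; at any time process the front job of the non-empty queue of lowest index; whenever a job $j\in Q_i$ has received total processing $(1+\delta)^{i+1}$, move it to the end of $Q_{i+1}$. Adapted PMLF with parameters $\delta,\gamma>0$ and $g$: run PMLF until the time $T$ at which the number of unfinished jobs is at most $g/\gamma$. At time $T$, let $q_j(T)$ be the total processing job $j$ has received by time $T$, and move each unfinished job $j$ to the end of the queue $Q_k$ with $(1+\delta)^k\le q_j(T)<(1+\delta)^{k+1}$.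 Afterwards continue with PMLF.
   Formalization: log_2(p_j/p̂_j) is replaced by max(0, log_2(p_j/p̂_j)), as the bound can otherwise be negative; ε is restricted to (0,1], as the bound with an absolute constant fails for large ε; jobs with q_j(T)=0, for which no queue is defined, go to Q_0. *)

(* Defs.v *)
From mathcomp Require Import all_boot all_order all_algebra.
From mathcomp Require Import classical_sets reals exp.
Set Implicit Arguments. Unset Strict Implicit. Unset Printing Implicit Defensive.
Import Order.TTheory GRing.Theory Num.Theory.
Local Open Scope ring_scope.

Definition log2 {R : realType} (x : R) : R := ln x / ln 2.

Definition qlevel {R : realType} (delta x : R) : int :=
  Num.floor (ln x / ln (1 + delta)).

(* level used at the adaptation time T for a job that received q units;
   convention: a job with q = 0 goes to queue 0 *)
Definition adapt_level {R : realType} (delta q : R) : int :=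
  if q == 0 then 0%Z else qlevel delta q.

(* st_Q lists the unfinished jobs together with their queue index, in
   global order of insertion; restricted to one index this is exactly the
   FIFO order of that queue.                                            *)
Record pstate (R : realType) (n : nat) := PState {
  st_time    : R;
  st_q       : 'I_n -> R;           (* processing received so far *)
  st_C       : 'I_n -> R;           (* completion times (of finished jobs) *)
  st_Q       : seq ('I_n * int);
  st_adapted : bool;
  st_last    : option 'I_n;
  st_npre    : nat
}.

Definition fupd {R : realType} {n : nat} (f : 'I_n -> R) (b : 'I_n) (v : R) :=
  fun j => if j == b then v else f j.

Definition pmlf_init {R : realType} {n : nat} (delta : R) (phat : 'I_n -> R)
  (ord1 : seq 'I_n) : pstate R n :=
  PState (0 : R) (fun _ => 0) (fun _ => 0)
    [seq (j, qlevel delta (phat j)) | j <- ord1] false None 0%N.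

Definition pmlf_step {R : realType} {n : nat} (p : 'I_n -> R) (delta gamma : R)
  (g : nat) (ord2 : seq 'I_n) (s : pstate R n) : pstate R n :=
  match st_Q s with
  | [::] => s
  | e0 :: _ =>
    let Q := st_Q s in
    let unfinished := [seq e.1 | e <- Q] in
    if ~~ st_adapted s && ((size Q)%:R <= g%:R / gamma) then
      (* time T reached: move every unfinished job according to q_j(T) *)
      PState (st_time s) (st_q s) (st_C s)
        [seq (j, adapt_level delta (st_q s j)) | j <- ord2 & j \in unfinished]
        true (st_last s) (st_npre s)
    else
      let m := foldr (fun e a => Num.min e.2 a) e0.2 Q in
      (* front job of the non-empty queue of lowest index *)
      let b := (nth e0 Q (find (fun e => e.2 == m) Q)).1 in
      let np := if st_last s is Some a then
                  (if (a != b) && (a \in unfinished) then (st_npre s).+1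
                   else st_npre s)
                else st_npre s in
      let t := st_time s in
      let r := p b - st_q s b in
      let room := (1 + delta) ^ (m + 1) - st_q s b in
      let Q' := [seq e <- Q | e.1 != b] in
      if r <= room then
        PState (t + r) (fupd (st_q s) b (p b)) (fupd (st_C s) b (t + r))
          Q' (st_adapted s) (Some b) np
      else
        PState (t + room) (fupd (st_q s) b ((1 + delta) ^ (m + 1))) (st_C s)
          (rcons Q' (b, m + 1)) (st_adapted s) (Some b) np
  end.

Definition pmlf_run {R : realType} {n : nat} (p phat : 'I_n -> R)
  (delta gamma : R) (g : nat) (ord1 ord2 : seq 'I_n) (k : nat) : pstate R n :=
  iter k (pmlf_step p delta gamma g ord2) (pmlf_init delta phat ord1).

(* A (preemptive) offline schedule: a finite sequence of pieces
   (Some j, d) = process j for d time units, (None, d) = idle d units. *)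
Definition feasible_sched {R : realType} {n : nat} (p : 'I_n -> R)
  (s : seq (option 'I_n * R)) : Prop :=
  (forall x, x \in s -> 0 <= x.2) /\
  (forall j, p j <= \sum_(x <- s | x.1 == Some j) x.2).

Fixpoint sched_C {R : realType} {n : nat} (j : 'I_n) (s : seq (option 'I_n * R))
  (t r : R) : R :=
  match s with
  | [::] => t
  | x :: s' =>
      if (x.1 == Some j) && (r <= x.2) then t + r
      else sched_C j s' (t + x.2) (if x.1 == Some j then r - x.2 else r)
  end.

Definition sched_cost {R : realType} {n : nat} (p : 'I_n -> R)
  (s : seq (option 'I_n * R)) : R :=
  \sum_(j < n) sched_C j s 0 (p j).

Definition OPT {R : realType} {n : nat} (p : 'I_n -> R) : R :=
  inf [set c | exists s, feasible_sched p s /\ c = sched_cost p s].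

(* Main.v *)
Require Import Defs.
From mathcomp Require Import all_boot all_order all_algebra.
From mathcomp Require Import classical_sets reals exp.
From mathcomp Require Import ring lra.
Import Order.TTheory GRing.Theory Num.Theory.
Local Open Scope ring_scope.

(** Any schedule spends, before the completions of i and j, a total of at least
min(p_i, p_j) on i for j and on j for i, so 2 OPT is at least the sum of
min(p_i, p_j) over all ordered pairs.  The machine of PMLF never idles, so C_j
is the sum of the processing q_i received by all jobs at that time.  When j is
not overestimated, or after the adaptation time T, the queue index k of an
unfinished job j satisfies (1+delta)^k <= p_j, so a job served ahead of j never
exceeds (1+delta) p_j.  Hence C_j is at most the sum over i of
min(p_i, (1+delta) p_j), plus T if j is overestimated.  As more than g/gamma
jobs are unfinished before T, the extra cost g T is at most gamma times the cost
of the algorithm.  With delta = gamma = eps/4 the ratio is 2(1+eps).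

A preemption requires the interrupted job to have changed queue.  This happens
at most 1 + log_(1+delta)(p_j/phat_j) times from the initial queue of j, and
log_(1+delta) p_j times for the at most g/gamma jobs sent to queue 0 at T. *)

(** * Lower bound on the optimal cost *)

Section OptimalCost.
Context {R : realType} {n : nat}.
Implicit Types (s : seq (option 'I_n * R)) (p : 'I_n -> R).

(* Processing given to [i] before [j] completes, when [j] still needs [r]. *)
Fixpoint work_before (i j : 'I_n) s (r : R) : R :=
  match s with
  | [::] => 0
  | x :: s' =>
      if (x.1 == Some j) && (r <= x.2) then (if i == j then r else 0)
      else (if x.1 == Some i then x.2 else 0)
           + work_before i j s' (if x.1 == Some j then r - x.2 else r)
  end.

(** Idle pieces lengthen the completion time without serving any job, hence an inequality. *)
Lemma sum_work_before_le j s t r : (forall x, x \in s -> 0 <= x.2) ->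
  t + \sum_i work_before i j s r <= sched_C j s t r.
Proof.
elim: s t r => [|x s IH] t r s0 /=; first by rewrite big1 ?addr0.
have x0 : 0 <= x.2 by apply: s0; rewrite mem_head.
have {}s0 y : y \in s -> 0 <= y.2 by move=> ys; apply: s0; rewrite inE ys orbT.
case: (_ && _); first by rewrite -big_mkcond /= big_pred1_eq.
apply: le_trans (IH _ _ s0); rewrite big_split /= addrA lerD2r lerD2l.
rewrite -big_mkcond /=; case: (x.1) => [i|]; last by rewrite big_pred0.
by rewrite (big_pred1 i) // => k; rewrite /= eq_sym.
Qed.

Lemma work_before_ge0 i j s r : i != j -> (forall x, x \in s -> 0 <= x.2) ->
  0 <= work_before i j s r.
Proof.
move=> ij; elim: s r => [|x s IH] r s0 //=; rewrite (negPf ij).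
case: ifP => // _; apply: addr_ge0.
  by case: ifP => // _; apply: s0; rewrite mem_head.
by apply: IH => y ys; apply: s0; rewrite inE ys orbT.
Qed.

Lemma work_before_self j s r : r <= \sum_(x <- s | x.1 == Some j) x.2 ->
  r <= work_before j j s r.
Proof.
elim: s r => [|x s IH] r; rewrite ?big_nil // big_cons /= eqxx.
case: ifP => //= _; last by rewrite add0r; apply: IH.
by case: ifP => // _ H; rewrite -lerBlDl; apply: IH; rewrite lerBlDl.
Qed.

(** Induction on the schedule with residual requirements. A piece of length [d] on one of the two
    jobs that does not finish it lowers the minimum by at most [d], and this [d] is counted on the
    right. A piece that finishes it already counts its whole residual requirement. *)
Lemma work_before_pair i j s ri rj : i != j ->
  (forall x, x \in s -> 0 <= x.2) ->
  ri <= \sum_(x <- s | x.1 == Some i) x.2 ->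
  rj <= \sum_(x <- s | x.1 == Some j) x.2 ->
  Num.min ri rj <= work_before i j s rj + work_before j i s ri.
Proof.
move=> ij; elim: s ri rj => [|x s IH] ri rj s0.
  by rewrite !big_nil /= addr0 ge_min => ->.
have x0 : 0 <= x.2 by apply: s0; rewrite mem_head.
have {}s0 y : y \in s -> 0 <= y.2 by move=> ys; apply: s0; rewrite inE ys orbT.
rewrite !big_cons /= (negPf ij) [j == i]eq_sym (negPf ij).
have wij := work_before_ge0 i j s _ ij s0.
have wji := work_before_ge0 j i s _ _ s0.
have [xi|xi] := eqVneq x.1 (Some i).
  have -> /= : (x.1 == Some j) = false.
    by rewrite xi; apply/negP => /eqP -[] /eqP; rewrite (negPf ij).
  case: (leP ri x.2) => hr Hi Hj.
    by rewrite addr0 ge_min; apply/orP; left; apply: le_trans hr _; rewrite lerDl.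
  rewrite add0r -addrA -lerBlDl; apply: le_trans (IH _ _ s0 _ Hj).
    by rewrite le_min lerD2r ge_min lexx /= lerBlDl ge_min [X in _ || X]lerDr x0 orbT.
  by rewrite lerBlDl.
have [xj|xj] := eqVneq x.1 (Some j) => /=.
  case: (leP rj x.2) => hr Hi Hj.
    rewrite add0r ge_min; apply/orP; right; apply: le_trans hr _; rewrite lerDl.
    by apply: wji; rewrite eq_sym.
  rewrite add0r addrCA -lerBlDl; apply: le_trans (IH _ _ s0 Hi _).
    by rewrite le_min lerD2r [X in _ && X]ge_min lexx orbT andbT lerBlDl ge_min lerDr x0.
  by rewrite lerBlDl.
by rewrite !add0r; apply: IH.
Qed.

Lemma OPT_ge p : (forall j, 0 <= p j) ->
  \sum_i \sum_j Num.min (p i) (p j) <= 2 * OPT p.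
Proof.
move=> p0; rewrite mulrC -ler_pdivrMr //.
apply: lb_le_inf.
  (* The infimum is bounded below only over a nonempty set; running the jobs one after another gives
     an element. *)
  exists (sched_cost p [seq (Some j, p j) | j <- enum 'I_n]).
  exists [seq (Some j, p j) | j <- enum 'I_n]; split=> //; split.
    by move=> x /mapP[j _ ->]; exact: p0.
  by move=> j; rewrite big_map big_enum_cond /= (big_pred1 j).
move=> _ [s [[s0 sp] ->]]; rewrite ler_pdivrMr //.
have H : \sum_j \sum_i work_before i j s (p j) <= sched_cost p s.
  apply: ler_sum => j _; have := sum_work_before_le j s 0 (p j) s0.
  by rewrite add0r.
apply: (@le_trans _ _ (\sum_i \sum_j (work_before i j s (p j) + work_before j i s (p i)))).
  apply: ler_sum => i _; apply: ler_sum => j _.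
  (* On the diagonal the work of [i] is counted twice, which is harmless as [0 <= p i]. *)
  have [<-|ij] := eqVneq i j; last exact: work_before_pair.
  have := work_before_self i s (p i) (sp i); have := p0 i; rewrite minxx; lra.
under eq_bigr do rewrite big_split /=.
rewrite big_split /= exchange_big /=; lra.
Qed.

End OptimalCost.

(** * Queue levels and powers of [1 + delta] *)

Section Levels.
Context {R : realType}.
Variable delta : R.
Hypothesis delta0 : 0 < delta.

Lemma ln1D_gt0 : 0 < ln (1 + delta).
Proof. by rewrite ln_gt0 // ltrDl. Qed.

Lemma exprz1D_gt0 (k : int) : 0 < (1 + delta) ^ k.
Proof. by apply: exprz_gt0; rewrite addr_gt0. Qed.

Lemma ler_exprz1D (k l : int) : ((1 + delta) ^ k <= (1 + delta) ^ l) = (k <= l).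
Proof. by rewrite ler_eXz2l // ltrDl. Qed.

Lemma exprz1DS (k : int) : (1 + delta) ^ (k + 1) = (1 + delta) * (1 + delta) ^ k.
Proof. by rewrite expfzDr ?expr1z 1?mulrC // gt_eqF // addr_gt0. Qed.

Lemma ln_exprz1D (k : int) : ln ((1 + delta) ^ k) = k%:~R * ln (1 + delta).
Proof. by rewrite -powR_intmul ?ln_powR // addr_ge0 // ltW. Qed.

Lemma exprz1D_le (k : int) (x : R) : 0 < x ->
  ((1 + delta) ^ k <= x) = (k%:~R <= ln x / ln (1 + delta)).
Proof.
move=> x0; rewrite ler_pdivlMr ?ln1D_gt0 // -ln_exprz1D ler_ln //.
by rewrite posrE exprz1D_gt0.
Qed.

Lemma qlevel_le (x : R) : 0 < x -> (1 + delta) ^ qlevel delta x <= x.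
Proof. by move=> x0; rewrite exprz1D_le // floor_le. Qed.

Lemma lt_qlevelS (x : R) : 0 < x -> x < (1 + delta) ^ (qlevel delta x + 1).
Proof. by move=> x0; rewrite ltNge exprz1D_le // -ltNge floorD1_gt. Qed.

(** A job promoted before the adaptation has received exactly a power of [1 + delta], so the
    adaptation leaves it on its level. *)
Lemma qlevel_exprz (k : int) : qlevel delta ((1 + delta) ^ k) = k.
Proof.
rewrite /qlevel ln_exprz1D mulfK ?gt_eqF ?ln1D_gt0 //.
by apply: floor_def; rewrite lexx ltr_int ltrDl.
Qed.

End Levels.

(** * Single steps of the algorithm *)

Section Trajectory.
Context {R : realType} {n : nat}.
Variables (p phat : 'I_n -> R) (delta gamma : R) (g : nat) (ord1 ord2 : seq 'I_n).
Hypotheses (delta0 : 0 < delta) (gamma0 : 0 < gamma).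
Hypotheses (ord1P : perm_eq ord1 (enum 'I_n)) (ord2P : perm_eq ord2 (enum 'I_n)).
Hypotheses (p1 : forall j, 1 <= p j) (phat0 : forall j, 0 < phat j).

Local Notation state := (pstate R n).
Local Notation step := (pmlf_step p delta gamma g ord2).
Local Notation run := (pmlf_run p phat delta gamma g ord1 ord2).

Definition unfinished (s : state) : seq 'I_n := [seq e.1 | e <- st_Q s].

Definition adapt (s : state) : state :=
  PState (st_time s) (st_q s) (st_C s)
    [seq (j, adapt_level delta (st_q s j)) | j <- ord2 & j \in unfinished s]
    true (st_last s) (st_npre s).

(** A pending preemption: the next service may interrupt the job served last. It is charged in
    advance, when that job changes queue. *)
Definition preempted (s : state) : bool :=
  if st_last s is Some a then a \in unfinished s else false.

(* Total processing of [b] at the end of its service from queue [m]. *)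
Definition served (b : 'I_n) (m : int) : R := Num.min (p b) ((1 + delta) ^ (m + 1)).

(** Completion and promotion share one formula for time and received processing. The counter [np]
    stays a parameter, since only an upper bound on it matters. *)
Definition serve (s : state) (b : 'I_n) (m : int) (np : nat) : state :=
  let t := st_time s + (served b m - st_q s b) in
  let Q' := [seq e <- st_Q s | e.1 != b] in
  let complete := p b <= (1 + delta) ^ (m + 1) in
  PState t (fupd (st_q s) b (served b m))
    (if complete then fupd (st_C s) b t else st_C s)
    (if complete then Q' else rcons Q' (b, m + 1))
    (st_adapted s) (Some b) np.

Variant step_spec (s : state) : state -> Prop :=
| StepAdapt of ~~ st_adapted s & (size (st_Q s))%:R <= g%:R / gamma :
    step_spec s (adapt s)
| StepServe b m np of st_adapted s || (g%:R / gamma < (size (st_Q s))%:R)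
    & (b, m) \in st_Q s & (forall e, e \in st_Q s -> m <= e.2)
    & (np <= st_npre s + preempted s)%N :
    step_spec s (serve s b m np).

Lemma foldr_min_mem (T : eqType) (f : T -> int) x0 s : x0 \in s ->
  has (fun e => f e == foldr (fun e a => Num.min (f e) a) (f x0) s) s.
Proof.
move=> x0s; set F := foldr _ _.
have : F s == f x0 \/ has (fun e => f e == F s) s.
  elim: s {x0s} => [|x s IH] /=; first by left.
  case: leP => _; first by right; rewrite eqxx.
  by case: IH => [|h]; [left | right; rewrite h orbT].
by case=> // /eqP h; apply/hasP; exists x0; rewrite ?h.
Qed.

Lemma foldr_min_le (T : eqType) (f : T -> int) a s e : e \in s ->
  foldr (fun e a => Num.min (f e) a) a s <= f e.
Proof.
elim: s => //= x s IH; rewrite inE => /predU1P[->|/IH h].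
  by rewrite ge_min lexx.
by rewrite ge_min h orbT.
Qed.

Lemma stepP s : st_Q s != [::] -> step_spec s (step s).
Proof.
move=> Q0; rewrite /pmlf_step.
case Qe: {1}(st_Q s) => [|e0 Q1]; first by rewrite Qe in Q0.
have e0s : e0 \in st_Q s by rewrite Qe mem_head.
case: ifP => [/andP[na sz]|h]; first exact: StepAdapt.
set m := foldr _ _ _; set e := nth _ _ _; set np := (X in PState _ _ _ _ _ _ X).
have hasm : has (fun e => e.2 == m) (st_Q s).
  exact: (@foldr_min_mem _ snd e0 (st_Q s) e0s).
have es : e \in st_Q s by rewrite mem_nth // -has_find.
have em : e.2 = m by apply/eqP; exact: (nth_find e0 hasm).
have bm : (e.1, m) \in st_Q s by rewrite -em -surjective_pairing.
have mmin x : x \in st_Q s -> m <= x.2 by move=> /(@foldr_min_le _ snd); apply.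
have hnp : (np <= st_npre s + preempted s)%N.
  rewrite /np /preempted; case: (st_last s) => [a|]; last by rewrite addn0.
  by rewrite -/(unfinished s); case: (a \in _); rewrite ?andbF ?andbT ?addn0 //;
     case: (a != _); rewrite ?addn1 // ?addn0.
have had : st_adapted s || (g%:R / gamma < (size (st_Q s))%:R).
  by move: h; case: (st_adapted s) => //= /negbT; rewrite ltNge.
have := StepServe s e.1 m np had bm mmin hnp.
rewrite /serve /served lerD2r; case: leP => _; exact.
Qed.

Lemma unfinished_adapt s : unfinished (adapt s) =i unfinished s.
Proof.
move=> j; rewrite /unfinished /adapt /= -map_comp map_id.
by rewrite mem_filter (perm_mem ord2P) mem_enum andbT.
Qed.

Lemma unfinished_serve s b m np j : (b, m) \in st_Q s ->
  (j \in unfinished (serve s b m np)) =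
  (j \in unfinished s) && ~~ ((j == b) && (p b <= (1 + delta) ^ (m + 1))).
Proof.
move=> bm; have bs : b \in unfinished s by apply/mapP; exists (b, m).
have H : (j \in [seq e.1 | e <- [seq e <- st_Q s | e.1 != b]]) =
         (j != b) && (j \in unfinished s).
  by rewrite -(filter_map fst (predC1 b)) mem_filter.
rewrite {1}/unfinished /serve /=; case: ifP => _.
  by rewrite H andbT andbC.
rewrite map_rcons mem_rcons inE H andbF andbT /=.
by case: eqVneq => [->|].
Qed.

(** * Invariants on time, received processing and levels *)

Record state_inv (s : state) : Prop := StateInv {
  inv_uniq : uniq (unfinished s);
  inv_time : st_time s = \sum_i st_q s i;
  inv_q_ge0 : forall i, 0 <= st_q s i;
  inv_q_le : forall i, st_q s i <= p i;
  inv_q_lt : forall j k, (j, k) \in st_Q s -> st_q s j < (1 + delta) ^ (k + 1);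
  inv_level : forall j k, (j, k) \in st_Q s ->
    st_adapted s || (phat j <= p j) -> (1 + delta) ^ k <= p j
}.

Lemma mem_adaptP s j k : (j, k) \in st_Q (adapt s) ->
  j \in unfinished s /\ k = adapt_level delta (st_q s j).
Proof. by case/mapP => i; rewrite mem_filter => /andP[iu _] [-> ->]. Qed.

Lemma mem_serveP s b m np j k : (j, k) \in st_Q (serve s b m np) ->
  (j != b /\ (j, k) \in st_Q s) \/
  [/\ j = b, k = m + 1 & (1 + delta) ^ (m + 1) < p b].
Proof.
rewrite /serve /=; case: leP => h.
  by rewrite mem_filter /= => /andP[]; left.
rewrite mem_rcons inE => /predU1P[[-> ->]|]; first by right.
by rewrite mem_filter /= => /andP[]; left.
Qed.

Lemma p_gt0 j : 0 < p j.
Proof. exact: lt_le_trans (p1 j). Qed.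

Lemma state_inv_init : state_inv (pmlf_init delta phat ord1).
Proof.
split=> //=.
- rewrite /unfinished -map_comp map_id (perm_uniq ord1P); exact: enum_uniq.
- by rewrite big1.
- by move=> i; rewrite ltW // p_gt0.
- by move=> j k _; rewrite exprz1D_gt0.
move=> j k /mapP[i _ [-> ->]] h; apply: le_trans h; exact: qlevel_le.
Qed.

Lemma le_served s b m : state_inv s -> (b, m) \in st_Q s -> st_q s b <= served b m.
Proof. by move=> I bm; rewrite /served le_min inv_q_le // ltW // inv_q_lt. Qed.

Lemma sum_fupd (f : 'I_n -> R) b v : \sum_i fupd f b v i = \sum_i f i + (v - f b).
Proof.
rewrite (bigD1 b) //= [in RHS](bigD1 b) //= {1}/fupd eqxx.
rewrite (eq_bigr f) => [|i /negPf]; last by rewrite /fupd => ->.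
by ring.
Qed.

(** An overestimated job may start on a level above its size. Levels recomputed from the received
    processing cannot exceed it, so [inv_level] then holds for every job. *)
Lemma state_inv_adapt s : state_inv s -> state_inv (adapt s).
Proof.
move=> I; split=> //=; try by case: I.
- rewrite /unfinished /adapt /= -map_comp map_id filter_uniq //.
  by rewrite (perm_uniq ord2P) enum_uniq.
- move=> j k /mem_adaptP[_ ->]; rewrite /adapt_level; case: eqVneq => [->|q0].
    exact: exprz1D_gt0.
  by apply: lt_qlevelS; rewrite // lt_def q0 inv_q_ge0.
(* A job that has received nothing goes to queue 0, which is sound because [1 <= p j]. *)
- move=> j k /mem_adaptP[_ ->] _; rewrite /adapt_level; case: eqVneq => [_|q0].
    by rewrite expr0z.
  apply: le_trans (inv_q_le s I j); apply: qlevel_le => //.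
  by rewrite lt_def q0 inv_q_ge0.
Qed.

Lemma state_inv_serve s b m np : state_inv s -> (b, m) \in st_Q s ->
  state_inv (serve s b m np).
Proof.
move=> I bm; have v_ge := le_served s b m I bm; split=> /=.
- have uQ : uniq [seq e.1 | e <- [seq e <- st_Q s | e.1 != b]].
    by rewrite -(filter_map fst (predC1 b)) filter_uniq // inv_uniq.
  rewrite /unfinished /serve /=; case: ifP => // _.
  rewrite map_rcons rcons_uniq uQ andbT -(filter_map fst (predC1 b)).
  by rewrite mem_filter /= eqxx.
- by rewrite sum_fupd inv_time.
- move=> i; rewrite /fupd; case: ifP => _; last exact: inv_q_ge0.
  exact: le_trans (inv_q_ge0 s I b) v_ge.
- move=> i; rewrite /fupd; case: eqP => [->|_]; last exact: inv_q_le.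
  by rewrite /served ge_min lexx.
- move=> j k /(mem_serveP s b m np)[[/negPf jb jk]|[-> -> h]]; rewrite /fupd.
    by rewrite jb; apply: inv_q_lt.
  rewrite eqxx /served (le_lt_trans (y := (1 + delta) ^ (m + 1))) //.
    by rewrite ge_min lexx orbT.
  by rewrite [ltRHS]exprz1DS // ltr_pMl ?ltrDl // exprz1D_gt0.
(* A promoted job has outlived its threshold, so it satisfies the level bound even if
   overestimated. *)
- move=> j k /(mem_serveP s b m np)[[_ jk]|[-> -> h _]]; last exact: ltW.
  exact: inv_level.
Qed.

(** * Bounds on the completion times *)

Definition over (j : 'I_n) : R := (p j < phat j)%R%:R.

Definition share (i j : 'I_n) : R := Num.min (p i) ((1 + delta) * p j).

(** Its sum over all jobs is the cost accrued so far, which grows at a rate equal to the number of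
    unfinished jobs and ends as the total completion time. *)
Definition clock (s : state) (j : 'I_n) : R :=
  if j \in unfinished s then st_time s else st_C s j.

(* [qT] is the processing received up to the adaptation time [T], or up to now
   before adaptation; thus [T] is the sum of [qT]. *)
Definition cost_inv (s : state) : Prop := exists qT : 'I_n -> R,
  [/\ forall i, 0 <= qT i,
      ~~ st_adapted s -> forall i, qT i = st_q s i,
      forall j, j \in unfinished s ->
        forall i, st_q s i <= over j * qT i + share i j,
      forall j, j \notin unfinished s ->
        st_C s j <= \sum_i (over j * qT i + share i j)
    & g%:R * \sum_i qT i <= gamma * \sum_j clock s j].

Lemma over_ge0 j : 0 <= over j. Proof. exact: ler0n. Qed.

Lemma share_ge0 i j : 0 <= share i j.
Proof.
rewrite /share le_min ltW ?p_gt0 //= mulr_ge0 // ltW ?p_gt0 //.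
by rewrite addr_gt0.
Qed.

Lemma cost_inv_init : cost_inv (pmlf_init delta phat ord1).
Proof.
have all_unf j : j \in unfinished (pmlf_init delta phat ord1).
  by rewrite /unfinished -map_comp map_id (perm_mem ord1P) mem_enum.
exists (fun=> 0); split=> //=.
- by move=> j _ i; rewrite mulr0 add0r share_ge0.
- by move=> j; rewrite all_unf.
by rewrite !big1 ?mulr0 // => j _; rewrite /clock all_unf.
Qed.

Lemma cost_inv_adapt s : cost_inv s -> cost_inv (adapt s).
Proof.
move=> [qT [q0 _ bq bC bT]]; exists qT; split=> //.
- by move=> j; rewrite unfinished_adapt; exact: bq.
- by move=> j; rewrite unfinished_adapt; exact: bC.
have -> // : \sum_j clock (adapt s) j = \sum_j clock s j.
by apply: eq_bigr => j _; rewrite /clock unfinished_adapt.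
Qed.

Lemma sum_clock_serve s b m np : state_inv s -> (b, m) \in st_Q s ->
  \sum_j clock (serve s b m np) j =
  \sum_j clock s j + (size (st_Q s))%:R * (served b m - st_q s b).
Proof.
move=> I bm; have bs : b \in unfinished s by apply/mapP; exists (b, m).
have -> : (size (st_Q s))%:R = \sum_j (j \in unfinished s)%:R :> R.
  by rewrite -natr_sum -big_mkcond /= sum1_card (card_uniqP _) ?inv_uniq ?size_map.
rewrite mulr_suml -big_split /=; apply: eq_bigr => j _.
rewrite /clock unfinished_serve //; case: (boolP (j \in _)) => ju /=.
  rewrite mul1r; case: eqVneq => //= ->.
  by case: (p b <= _); rewrite /= ?/fupd ?eqxx.
rewrite mul0r addr0 /serve /=; case: ifP => // _; rewrite /fupd.
by case: eqP => // jb; rewrite jb bs in ju.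
Qed.

(** Only the processing of [b] grows, so for each unfinished [j] only the bound on [b] is at stake.
    If [b] completes, its completion time is the sum of all received processing, and the pointwise
    bounds add up. *)
Lemma cost_inv_serve s b m np : state_inv s -> cost_inv s ->
  st_adapted s || (g%:R / gamma < (size (st_Q s))%:R) -> (b, m) \in st_Q s ->
  (forall e, e \in st_Q s -> m <= e.2) -> cost_inv (serve s b m np).
Proof.
move=> I [qT [q0 qTE bq bC bT]] had bm mmin.
have v_ge := le_served s b m I bm.
have I' := state_inv_serve s b m np I bm.
(* [qT'] follows the received processing before the adaptation and is frozen afterwards. *)
pose s' := serve s b m np; pose qT' := if st_adapted s then qT else st_q s'.
have qT_le i : qT i <= qT' i.
  rewrite /qT'; case: ifPn => // na; rewrite qTE //= /fupd.
  by case: eqP => [->|].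
have bq' j : j \in unfinished s ->
    forall i, st_q s' i <= over j * qT' i + share i j.
  move=> ju i; have [->|ib] := eqVneq i b; last first.
    have -> : st_q s' i = st_q s i by rewrite /= /fupd (negPf ib).
    apply: le_trans (bq j ju i) _; rewrite lerD2r.
    by apply: ler_wpM2l; rewrite ?over_ge0 ?qT_le.
  have [ao|] := boolP (st_adapted s || (phat j <= p j)).
    apply: (@le_trans _ _ (share b j)); last first.
      rewrite lerDr mulr_ge0 ?over_ge0 //; exact: le_trans (qT_le b).
    (* As [b] comes from the lowest queue, [m <= k], so its threshold is at most
       [(1 + delta) * (1 + delta) ^ k], hence at most [(1 + delta) * p j] by [inv_level]. *)
    case/mapP: ju => -[j' k] jk /= jE; subst j'.
    rewrite /= /fupd eqxx /served /share le_min !ge_min lexx /=.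
    apply/orP; right; rewrite exprz1DS // ler_pM2l ?addr_gt0 //.
    apply: le_trans (inv_level s I j k jk ao).
    by rewrite ler_exprz1D //; exact: (mmin _ jk).
  (* An overestimated [j] before the adaptation: the term [over j * qT' i] alone covers everything
     received. *)
  rewrite negb_or -ltNge => /andP[na jo].
  by rewrite /qT' (negPf na) /over jo mul1r lerDl share_ge0.
have Cb : st_time s' <= \sum_i (over b * qT' i + share i b).
  rewrite inv_time //; apply: ler_sum => i _; apply: bq'.
  by apply/mapP; exists (b, m).
exists qT'; split.
- by move=> i; exact: le_trans (qT_le i).
- by rewrite /qT' /= => /negPf ->.
- by move=> j; rewrite unfinished_serve // => /andP[+ _]; exact: bq'.
- move=> j; rewrite unfinished_serve // negb_and negbK.
  have [->|jb] := eqVneq j b.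
    rewrite /=; have -> /= : b \in unfinished s by apply/mapP; exists (b, m).
    by move=> h; rewrite h /fupd eqxx.
  rewrite /= orbF => ju; rewrite /=.
  have -> : (if p b <= (1 + delta) ^ (m + 1) then
     fupd (st_C s) b (st_time s + (served b m - st_q s b)) else st_C s) j = st_C s j.
    by case: ifP => // _; rewrite /fupd (negPf jb).
  apply: le_trans (bC j ju) _; apply: ler_sum => i _; rewrite lerD2r.
  by apply: ler_wpM2l; rewrite ?over_ge0 ?qT_le.
rewrite sum_clock_serve // mulrDr.
have dt : 0 <= served b m - st_q s b by rewrite subr_ge0.
have [ad|na] := boolP (st_adapted s).
  rewrite /qT' ad; apply: le_trans bT _; rewrite lerDl.
  by rewrite !mulr_ge0 // ltW.
(* More than [g / gamma] clocks advance with the service, so [gamma] times their total advance pays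
   for [g] times the advance of [T]. *)
rewrite (negPf na) /= in had.
rewrite /qT' (negPf na) /s' /= sum_fupd mulrDr; apply: lerD.
  by move: bT; rewrite (eq_bigr _ (fun i _ => qTE na i)).
rewrite mulrA; apply: ler_wpM2r => //.
by rewrite mulrC -ler_pdivrMr // ltW.
Qed.

(** * Counting promotions and preemptions *)

Definition promotions (j : 'I_n) : R :=
  1 + Num.max 0 (ln (p j / phat j) / ln (1 + delta)).

Definition reset_promotions (j : 'I_n) : R := ln (p j) / ln (1 + delta).

(* [N j] counts the services of [j] that ended with [j] changing queue, and [S]
   is the set of jobs that the adaptation sends back to level 0. *)
Definition preempt_inv (steps : nat) (s : state) : Prop :=
  exists (N : 'I_n -> nat) (S : pred 'I_n),
  [/\ #|S|%:R <= g%:R / gamma /\ (~~ st_adapted s -> S =i pred0),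
      (st_npre s + preempted s <= \sum_j N j)%N /\
      forall j, (N j)%:R <= promotions j + (j \in S)%:R * reset_promotions j,
      forall j k, (j, k) \in st_Q s ->
        (N j)%:Z <= k - qlevel delta (phat j) \/ (j \in S /\ (N j)%:Z <= k),
      ~~ st_adapted s -> forall j k, (j, k) \in st_Q s ->
        (k = qlevel delta (phat j) /\ st_q s j = 0) \/
        st_q s j = (1 + delta) ^ k
    & st_Q s = [::] \/
      (steps <= \sum_j N j + #|[pred j | j \notin unfinished s]|
                + st_adapted s)%N].

Lemma promotions_ge1 j : 1 <= promotions j.
Proof. by rewrite lerDl le_max lexx. Qed.

Lemma reset_promotions_ge0 j : 0 <= reset_promotions j.
Proof. by rewrite divr_ge0 ?ln_ge0 // lerDl ltW. Qed.

(** Rounding down the initial level costs at most one extra promotion, which the summand 1 in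
    [promotions] pays for. *)
Lemma promotions_ge j (m : int) : (1 + delta) ^ m <= p j ->
  (m - qlevel delta (phat j))%:~R <= promotions j.
Proof.
rewrite exprz1D_le ?p_gt0 // => pm.
have hl : ln (phat j) / ln (1 + delta) <= (qlevel delta (phat j) + 1)%:~R.
  by rewrite ltW // floorD1_gt.
have -> : promotions j =
    1 + Num.max 0 (ln (p j) / ln (1 + delta) - ln (phat j) / ln (1 + delta)).
  by rewrite -mulrBl -ln_div ?posrE ?p_gt0.
rewrite intrD in hl; rewrite intrB.
have : ln (p j) / ln (1 + delta) - ln (phat j) / ln (1 + delta) <=
  Num.max 0 (ln (p j) / ln (1 + delta) - ln (phat j) / ln (1 + delta)).
  by rewrite le_max lexx orbT.
by move: hl pm; rewrite (_ : 1%:~R = 1) //; lra.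
Qed.

Lemma preempt_inv_init : preempt_inv 0 (pmlf_init delta phat ord1).
Proof.
exists (fun=> 0%N), pred0; split.
- by split; rewrite // card0 divr_ge0 // ltW.
- split=> [|j] /=; first by rewrite big1.
  by rewrite mul0r addr0 (le_trans ler01) ?promotions_ge1.
- by move=> j k /mapP[i _ [-> ->]]; left; rewrite subrr.
- by move=> _ j k /mapP[i _ [-> ->]]; left.
- by right.
Qed.

Lemma preempt_inv_adapt t s : state_inv s -> ~~ st_adapted s ->
  (size (st_Q s))%:R <= g%:R / gamma -> st_Q s != [::] ->
  preempt_inv t s -> preempt_inv t.+1 (adapt s).
Proof.
move=> I na sz Q0 [N [S [[_ S0] [np NB] NQ QL tB]]].
have {}S0 := S0 na.
(* Only jobs that have received nothing are reset to level 0 by convention; every other job keeps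
   its level. *)
exists N, [pred j | (j \in unfinished s) && (st_q s j == 0)]; split.
- split=> //; apply: le_trans sz; rewrite ler_nat.
  rewrite -(size_map fst) -/(unfinished s).
  apply: leq_trans (card_size _); apply: subset_leq_card.
  by apply/fintype.subsetP => j; rewrite inE => /andP[].
- split=> [|j].
    apply: leq_trans np; rewrite leq_add2l /preempted /=.
    by case: (st_last s) => // a; rewrite unfinished_adapt.
  apply: le_trans (NB j) _.
  by rewrite S0 mul0r lerD2l mulr_ge0 ?reset_promotions_ge0.
- move=> j k /mem_adaptP[ju ->]; rewrite inE ju /=.
  case/mapP: (ju) => -[j' k'] jk /= jE; subst j'.
  have [Nj|[]] := NQ j k' jk; last by rewrite S0.
  rewrite /adapt_level; case: eqVneq => [q0|q0]; last first.
    have [[_ /eqP]|->] := QL na j k' jk; first by rewrite (negPf q0).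
    by rewrite qlevel_exprz //; left.
  (* An unserved job is still in its initial queue, so its count is 0; the alternative would make a
     power of [1 + delta] vanish. *)
  right; split=> //.
  have [[kE _]|qE] := QL na j k' jk; first by rewrite kE subrr in Nj.
  by have := exprz1D_gt0 _ delta0 k'; rewrite -qE q0 ltxx.
- by [].
right; case: tB => [/eqP|]; first by rewrite (negPf Q0).
rewrite (negPf na) /= addn0 addn1 ltnS => /leq_trans; apply.
rewrite leq_add2l; apply: subset_leq_card; apply/fintype.subsetP => j.
by rewrite !inE unfinished_adapt.
Qed.

(** A service that completes [b] leaves no pending preemption and enlarges the set of finished jobs.
    One that promotes [b] raises [N b] by one, which pays both for the pending preemption and for
    the step. *)
Lemma preempt_inv_serve t s b m np : state_inv s -> (b, m) \in st_Q s ->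
  (np <= st_npre s + preempted s)%N ->
  preempt_inv t s -> preempt_inv t.+1 (serve s b m np).
Proof.
move=> I bm hnp [N [S [hS [hN NB] NQ QL tB]]].
have bs : b \in unfinished s by apply/mapP; exists (b, m).
have {}tB : (t <= \sum_j N j + #|[pred j | j \notin unfinished s]|
                  + st_adapted s)%N.
  by case: tB => // Q0; rewrite Q0 in bm.
have [pb|pb] := leP (p b) ((1 + delta) ^ (m + 1)).
  have unfE j : (j \in unfinished (serve s b m np)) =
                (j \in unfinished s) && (j != b).
    by rewrite unfinished_serve // pb andbT.
  exists N, S; split=> //.
  - split=> //; rewrite /preempted /= unfE eqxx andbF addn0.
    exact: leq_trans hN.
  - move=> j k /(mem_serveP s b m np)[[_ jk]|[_ _]]; first exact: NQ.
    by rewrite ltNge pb.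
  - move=> na j k /(mem_serveP s b m np)[[jb jk]|[_ _]]; last by rewrite ltNge pb.
    by rewrite /= /fupd (negPf jb); exact: QL.
  right; rewrite [st_adapted _]/=; apply: leq_ltn_trans tB _.
  rewrite ltn_add2r ltn_add2l; apply: proper_card; apply/fintype.properP; split.
    by apply/fintype.subsetP => j; rewrite !inE unfE negb_and => ->.
  by exists b; rewrite !inE ?unfE ?bs // eqxx andbF.
have unfE j : (j \in unfinished (serve s b m np)) = (j \in unfinished s).
  by rewrite unfinished_serve // leNgt pb andbF andbT.
pose N' j := (N j + (j == b))%N.
have sumN' : (\sum_j N' j = (\sum_j N j).+1)%N.
  rewrite big_split /= -addn1; congr addn.
  by rewrite -big_mkcond /= sum1_card card1.
exists N', S; split=> //.
- split=> [|j].
    by rewrite /preempted /= unfE bs sumN' addn1 ltnS; exact: leq_trans hN.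
  rewrite /N'; case: eqVneq => [->|_]; last by rewrite addn0.
  rewrite natrD; have [Nb|[bS Nb]] := NQ b m bm.
    apply: (@le_trans _ _ (promotions b)); last first.
      by rewrite lerDl mulr_ge0 ?reset_promotions_ge0.
    apply: le_trans (promotions_ge b (m + 1) (ltW pb)).
    by rewrite addrAC intrD lerD2r -(ler_int R) in Nb *.
  rewrite bS mul1r; apply: (@le_trans _ _ (reset_promotions b)); last first.
    by rewrite lerDr (le_trans ler01) ?promotions_ge1.
  move: (ltW pb); rewrite exprz1D_le ?p_gt0 //; apply: le_trans.
  by rewrite intrD lerD2r -(ler_int R) in Nb *.
- move=> j k /(mem_serveP s b m np)[[jb jk]|[-> -> _]]; rewrite /N'.
    by rewrite (negPf jb) addn0; exact: NQ.
  rewrite eqxx PoszD; have [Nb|[bS Nb]] := NQ b m bm.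
    by left; rewrite addrAC lerD2r.
  by right; split; rewrite // lerD2r.
- move=> na j k /(mem_serveP s b m np)[[jb jk]|[-> -> _]]; rewrite /= /fupd.
    by rewrite (negPf jb); exact: QL.
  by right; rewrite eqxx /served; apply/min_idPr/ltW.
right; rewrite sumN' !addSn ltnS [st_adapted _]/=; apply: leq_trans tB _.
rewrite leq_add2r leq_add2l; apply: subset_leq_card; apply/fintype.subsetP => j.
by rewrite !inE unfE.
Qed.

(** * Induction along the run: termination, cost and preemptions *)

Lemma run_inv t : [/\ state_inv (run t), cost_inv (run t) & preempt_inv t (run t)].
Proof.
elim: t => [|t [I C P]].
  split; [exact: state_inv_init | exact: cost_inv_init | exact: preempt_inv_init].
rewrite /pmlf_run iterS -/(run t).
have [Q0|Q0] := eqVneq (st_Q (run t)) [::].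
  have -> : step (run t) = run t by rewrite /pmlf_step Q0.
  split=> //; case: P => N [S [? ? ? ? _]]; exists N, S; split=> //; by left.
case: (stepP (run t) Q0) => [na sz|b m np had bm mmin hnp].
  split; first exact: state_inv_adapt.
    exact: cost_inv_adapt.
  exact: preempt_inv_adapt.
split; first exact: state_inv_serve.
  exact: cost_inv_serve.
exact: preempt_inv_serve.
Qed.

Lemma run_terminates : exists t, st_Q (run t) = [::].
Proof.
(* While the queues are nonempty, each step is a promotion, one of at most [n] completions, or the
   single adaptation. *)
pose B := \sum_j (promotions j + reset_promotions j) + n.+1%:R.
have B0 : 0 <= B.
  apply: addr_ge0 => //; apply: sumr_ge0 => j _.
  by rewrite addr_ge0 ?reset_promotions_ge0 // (le_trans ler01) ?promotions_ge1.
exists (Num.bound B); set t := Num.bound B.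
have [_ _ [N [S [_ [_ NB] _ _ [//|tB]]]]] := run_inv t.
have : B < t%:R by exact: archi_boundP.
rewrite ltNge => /negP[]; move: tB; rewrite -(ler_nat R) => /le_trans; apply.
rewrite /B -addnA natrD; apply: lerD.
  rewrite natr_sum; apply: ler_sum => j _; apply: le_trans (NB j) _.
  rewrite lerD2l; case: (j \in S); rewrite ?mul1r // mul0r.
  exact: reset_promotions_ge0.
rewrite ler_nat -addn1 leq_add ?leq_b1 //.
by apply: leq_trans (max_card _) _; rewrite card_ord.
Qed.

(** Summing the bounds on [C_j] gives at most [g * T] plus all shares. The first term is at most
    [gamma] times the cost and moves to the left; the shares are compared with [OPT_ge]. *)
Lemma run_cost t : (#|[pred j | (p j < phat j)%R]| <= g)%N ->
  st_Q (run t) = [::] ->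
  (1 - gamma) * \sum_j st_C (run t) j <= 2 * (1 + delta) * OPT p.
Proof.
move=> gP Q0; have [_ [qT [q0 _ _ bC bT]] _] := run_inv t.
have unf0 j : j \in unfinished (run t) = false by rewrite /unfinished Q0.
have ck : \sum_j clock (run t) j = \sum_j st_C (run t) j.
  by apply: eq_bigr => j _; rewrite /clock unf0.
rewrite ck in bT.
have T0 : 0 <= \sum_i qT i by apply: sumr_ge0.
have CB : \sum_j st_C (run t) j <=
    \sum_j over j * \sum_i qT i + \sum_j \sum_i share i j.
  rewrite -big_split /=; apply: ler_sum => j _.
  by rewrite mulr_sumr -big_split /=; apply: bC; rewrite unf0.
have overT : \sum_j over j * \sum_i qT i <= g%:R * \sum_i qT i.
  rewrite -mulr_suml ler_wpM2r // /over -natr_sum -big_mkcond /= sum1_card.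
  by rewrite ler_nat.
have shareT : \sum_j \sum_i share i j <= 2 * (1 + delta) * OPT p.
  have p0 j : 0 <= p j by rewrite ltW ?p_gt0.
  rewrite mulrAC mulrC.
  apply: le_trans (ler_wpM2l _ (OPT_ge p p0)); last by rewrite addr_ge0 // ltW.
  rewrite exchange_big [leRHS]mulr_sumr /=.
  apply: ler_sum => i _; rewrite mulr_sumr; apply: ler_sum => j _.
  have d1 : 0 <= 1 + delta by rewrite addr_ge0 // ltW.
  rewrite minr_pMr // /share le_min !ge_min lexx orbT andbT.
  by rewrite ler_peMl // lerDl ltW.
lra.
Qed.

Lemma run_preemptions t :
  (st_npre (run t))%:R <= \sum_j promotions j
    + g%:R / gamma * (ln (\big[Num.max/1]_(j < n) p j) / ln (1 + delta)).
Proof.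
have [_ _ [N [S [[Sg _] [hN NB] _ _ _]]]] := run_inv t.
set L := _ / ln (1 + delta).
have LB j : reset_promotions j <= L.
  rewrite ler_pM2r ?invr_gt0 ?ln1D_gt0 // ler_ln ?posrE ?p_gt0 ?le_bigmax //.
  exact: lt_le_trans (p_gt0 j) (le_bigmax _ _ _).
have L0 : 0 <= L.
  by rewrite divr_ge0 ?ln_ge0 ?bigmax_ge_id // lerDl ltW.
apply: (@le_trans _ _ (\sum_j N j)%:R).
  by rewrite ler_nat; apply: leq_trans hN; rewrite leq_addr.
rewrite natr_sum; apply: (@le_trans _ _ (\sum_j (promotions j + (j \in S)%:R * L))).
  apply: ler_sum => j _; apply: le_trans (NB j) _.
  by rewrite lerD2l ler_wpM2l.
rewrite big_split lerD2l -mulr_suml ler_wpM2r //; apply: le_trans Sg.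
by rewrite -natr_sum -big_mkcond sum1_card.
Qed.

End Trajectory.

(** * Logarithm estimates and choice of the parameters *)

Lemma ler_ln1D {R : realType} (x : R) : 0 <= x -> x / (1 + x) <= ln (1 + x).
Proof.
move=> x0; have x1 : 0 < 1 + x by rewrite ltr_pwDl.
(* Since [1 / (1 + x) = 1 - x / (1 + x)], the bound is [ln (1 + y) <= y] at [y = - x / (1 + x)]. *)
have -> : ln (1 + x) = - ln (1 + - (x / (1 + x))).
  rewrite -lnV ?posrE; last by rewrite subr_gt0 ltr_pdivrMr // mul1r ltrDr.
  by congr (ln _); field; rewrite ?gt_eqF //; lra.
rewrite lerNr; apply: le_ln1Dx.
by rewrite ltrN2 ltr_pdivrMr // mul1r ltrDr.
Qed.

Lemma ln2_le1 {R : realType} : ln 2 <= 1 :> R.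
Proof. by apply: (@le_ln1Dx R 1); lra. Qed.

Theorem mainTheorem2 :
  forall R : realType, exists c : R, 0 < c /\
  forall eps : R, 0 < eps -> eps <= 1 ->
  exists delta gamma : R, 0 < delta /\ 0 < gamma /\
  forall (g n : nat) (p phat : 'I_n -> R) (ord1 ord2 : seq 'I_n),
    perm_eq ord1 (enum 'I_n) -> perm_eq ord2 (enum 'I_n) ->
    (forall j, 1 <= p j) -> (forall j, 0 < phat j) ->
    (#|[pred j : 'I_n | (p j < phat j)%R]| <= g)%N ->
    exists k : nat,
      let s := pmlf_run p phat delta gamma g ord1 ord2 k in
      st_Q s = [::] /\
      \sum_(j < n) st_C s j <= 2 * (1 + eps) * OPT p /\
      (st_npre s)%:R <=
        c * (eps^-1 * \sum_(j < n) (1 + Num.max 0 (log2 (p j / phat j)))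
             + g%:R / eps ^+ 2 * log2 (\big[Num.max/1]_(j < n) p j)).
Proof.
(* The constant is [4 * 8]: [g / d] is [4 * g / eps], and changing the base of the logarithm costs
   at most [8 / eps]. *)
move=> R; exists 32; split=> // eps eps0 eps1.
pose d := eps / 4; have d0 : 0 < d by rewrite divr_gt0.
have d1 : d <= 1 / 4 by rewrite /d; lra.
exists d, d; split=> //; split=> // g n p phat ord1 ord2 ord1P ord2P p1 phat0 gP.
have [t Q0] := run_terminates p phat d d g ord1 ord2 d0 d0 ord1P ord2P p1 phat0.
exists t => s; split=> //.
have p0 j : 0 < p j by exact: lt_le_trans (p1 j).
split.
  have := run_cost p phat d d g ord1 ord2 d0 d0 ord1P ord2P p1 phat0 t gP Q0.
  rewrite -/s => H.
  have OPT0 : 0 <= OPT p.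
    rewrite -(@pmulr_rge0 _ 2) //.
    apply: le_trans (OPT_ge p (fun j => ltW (p0 j))).
    by do 2!apply: sumr_ge0 => ? _; rewrite le_min !ltW.
  (* With [d = eps / 4] this amounts to [eps <= 2]. *)
  have dE : 1 + d <= (1 - d) * (1 + eps) by rewrite /d; nra.
  rewrite -(@ler_pM2l _ (1 - d)); last by lra.
  apply: le_trans H _; rewrite mulrA ler_wpM2r // mulrCA ler_pM2l //.
have l2 : 0 < ln 2 :> R by rewrite ln_gt0 // ltr1n.
have ld0 := ln1D_gt0 d d0.
(* From [ln (1 + d) >= d / (1 + d) = eps / (4 + eps)], which is at least [eps / 8]. *)
have ldV : (ln (1 + d))^-1 <= 8 / eps.
  rewrite -[leRHS]invrK lef_pV2 ?posrE ?invr_gt0 ?divr_gt0 //.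
  apply: le_trans (ler_ln1D d (ltW d0)).
  rewrite invf_div ler_pdivlMr ?addr_gt0 // /d; nra.
have lnE (x : R) : 0 <= ln x -> ln x / ln (1 + d) <= 8 / eps * log2 x.
  move=> lx; rewrite mulrC; apply: ler_pM => //; first by rewrite invr_ge0 ltW.
  by rewrite /log2 ler_pdivlMr // ler_piMr // ln2_le1.
apply: le_trans (run_preemptions p phat d d g ord1 ord2 d0 d0 ord1P ord2P p1 phat0 t) _.
(* This lets the factor [8 / eps] also absorb the summand 1 of [promotions]. *)
have e8 : 1 <= 8 / eps by rewrite ler_pdivlMr //; lra.
rewrite mulrDr; apply: lerD.
  rewrite mulrA mulr_sumr; apply: ler_sum => j _.
  apply: (@le_trans _ _ (8 / eps * (1 + Num.max 0 (log2 (p j / phat j))))).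
    rewrite mulrDr mulr1; apply: lerD => //.
    rewrite maxr_pMr ?mulr0; last by rewrite (le_trans ler01).
    rewrite ge_max le_max lexx /=.
    have [lx|lx] := leP 0 (ln (p j / phat j)).
      by rewrite le_max lnE ?orbT.
    by rewrite le_max pmulr_lle0 ?invr_gt0 // (ltW lx).
  apply: ler_wpM2r.
    by rewrite addr_ge0 // le_max lexx.
  by rewrite ler_pM2r ?invr_gt0 // ler_nat.
have lm : 0 <= ln (\big[Num.max/1]_(j < n) p j) by rewrite ln_ge0 // bigmax_ge_id.
apply: (@le_trans _ _ (g%:R / d * (8 / eps * log2 (\big[Num.max/1]_(j < n) p j)))).
  by apply: ler_wpM2l; rewrite ?lnE // divr_ge0 // ltW.
rewrite le_eqVlt; apply/orP; left; apply/eqP.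
rewrite /d; field; rewrite gt_eqF //.
Qed.
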